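(* Let $n\geq1$, let $\lambda_1,\ldots,\lambda_n,C\in\mathbb{R}\setminus\{0\}$ and $\alpha\in\mathbb{R}$ be constants, $I$ an open interval in $\mathbb{R}$, and let smooth functions $\theta:I\to\mathbb{R}$ or $\mathbb{R}/2\pi\mathbb{Z}$ and $w_1,\ldots,w_n:I\to\mathbb{C}\setminus\{0\}$ satisfy on $I$ $$(1)\qquad \frac{dw_j}{ds}=\lambda_j e^{i\theta(s)}\,\overline{w_1\cdots w_{j-1}w_{j+1}\cdots w_n},\quad j=1,\ldots,n,\qquad \frac{d\theta}{ds}=\alpha\,\mathrm{Im}\bigl(e^{-i\theta(s)}w_1\cdots w_n\bigr).$$ Let $L=\{(x_1w_1(s),\ldots,x_nw_n(s)): s\in I,\ x_j\in\mathbb{R},\ \sum_{j=1}^n\lambda_jx_j^2=C\}\subset\mathbb{C}^n$. Write $w_j\equiv r_je^{i\phi_j}$ and $\phi=\sum_{j=1}^n\phi_j$, for functions $r_j:I\to(0,\infty)$ and $\phi_1,\ldots,\phi_n,\phi:I\to\mathbb{R}$ or $\mathbb{R}/2\pi\mathbb{Z}$. Fix $s_0\in I$ and define $u:I\to\mathbb{R}$ by $$u(s)=2\int_{s_0}^s r_1(t)\cdots r_n(t)\cos\bigl(\phi(t)-\theta(t)\bigr)\,dt.$$ Then $r_j^2(s)\equiv\alpha_j+\lambda_ju(s)$ for $j=1,\ldots,n$ and $s\in I$, where $\alpha_j=r_j^2(s_0)$. Define a degree $n$ polynomial $Q(u)=\prod_{j=1}^n(\alpha_j+\lambda_ju)$.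 Then (under the substitution $w_j=\sqrt{\alpha_j+\lambda_ju}\,e^{i\phi_j}$, $\phi=\sum_j\phi_j$) the system (1) can be rewritten as $$(2)\qquad\begin{cases}\dfrac{du}{ds}=2Q(u)^{1/2}\cos(\phi-\theta),\\[4pt] \dfrac{d\phi_j}{ds}=-\dfrac{\lambda_jQ(u)^{1/2}\sin(\phi-\theta)}{\alpha_j+\lambda_ju},\quad j=1,\ldots,n,\\[4pt] \dfrac{d\phi}{ds}=-Q(u)^{1/2}(\ln Q(u))'\sin(\phi-\theta),\\[4pt] \dfrac{d\theta}{ds}=\alpha Q(u)^{1/2}\sin(\phi-\theta).\end{cases}$$ The set $L$ may be rewritten as $$L=\Bigl\{\bigl(x_1\sqrt{\alpha_1+\lambda_1u(s)}\,e^{i\phi_1(s)},\ldots,x_n\sqrt{\alpha_n+\lambda_nu(s)}\,e^{i\phi_n(s)}\bigr): x_1,\ldots,x_n\in\mathbb{R},\ s\in I,\ \sum_{j=1}^n\lambda_jx_j^2=C\Bigr\}.$$ Moreover, for some $A\in\mathbb{R}$ the equations (2) have the first integral $$Q(u)^{1/2}e^{\alpha u/2}\sin(\phi-\theta)\equiv A.$$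
   Context: The functions $r_j,\phi_j,\phi$ are smooth ($\phi_j$ being a continuous choice of argument of $w_j$). $(\ln Q(u))'$ denotes the derivative of $\ln Q$ with respect to $u$, evaluated at $u=u(s)$, i.e. $\sum_j\lambda_j/(\alpha_j+\lambda_ju)$. Empty products are $1$. *)

(* Defs.v *)
From HB Require Import structures.
From mathcomp Require Import all_boot all_order all_algebra generic_quotient.
From mathcomp Require Import all_classical all_reals all_analysis.
From mathcomp Require Import complex.

Set Implicit Arguments.
Unset Strict Implicit.
Unset Printing Implicit Defensive.

Import Order.TTheory GRing.Theory Num.Theory.
Import numFieldNormedType.Exports.

Local Open Scope classical_set_scope.
Local Open Scope ring_scope.

Section Circle.
Variable R : realType.

Definition two_pi_int : {pred R} :=
  fun x => `[< exists k : int, x = k%:~R * (2 * pi) >].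

Lemma two_pi_intP x :
  reflect (exists k : int, x = k%:~R * (2 * pi)) (x \in two_pi_int).
Proof. exact: asboolP. Qed.

Lemma two_pi_int_zmod_closed : zmod_closed two_pi_int.
Proof.
split; first by apply/two_pi_intP; exists 0; rewrite mul0r.
move=> x y /two_pi_intP[k ->] /two_pi_intP[l ->].
by apply/two_pi_intP; exists (k - l); rewrite intrB mulrBl.
Qed.

HB.instance Definition _ :=
  GRing.isZmodClosed.Build R two_pi_int two_pi_int_zmod_closed.

(* R / 2 pi Z, as an additive group *)
Definition circle : zmodType := Quotient.quot two_pi_int.

Definition to_circle (x : R) : circle := (\pi_(Quotient.quot two_pi_int) x)%qT.

(* Well defined on classes: see circle_cosE, circle_sinE. *)
Definition circle_cos (a : circle) : R :=
  cos (repr (a : Quotient.quot two_pi_int)).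
Definition circle_sin (a : circle) : R :=
  sin (repr (a : Quotient.quot two_pi_int)).

Lemma to_circleP x y :
  (exists k : int, x = y + k%:~R * (2 * pi)) <-> to_circle x = to_circle y.
Proof.
split.
  case=> k xy; apply/eqP; rewrite /to_circle -Quotient.idealrBE.
  by apply/two_pi_intP; exists k; rewrite xy addrC addKr.
move=> /eqP; rewrite /to_circle -Quotient.idealrBE => /two_pi_intP[k xy].
by exists k; rewrite -xy addrC subrK.
Qed.

Lemma to_circle_repr x :
  exists k : int,
    repr (to_circle x : Quotient.quot two_pi_int) = x + k%:~R * (2 * pi).
Proof. by apply/to_circleP; rewrite /to_circle reprK. Qed.

Lemma to_circleB : {morph to_circle : x y / x - y}.
Proof. by move=> x y; rewrite /to_circle raddfB. Qed.

Lemma cos_sin_periodz (x : R) (k : int) :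
  cos (x + k%:~R * (2 * pi)) = cos x /\ sin (x + k%:~R * (2 * pi)) = sin x.
Proof.
suff H (y : R) (m : nat) :
    cos (y + m%:R * (2 * pi)) = cos y /\ sin (y + m%:R * (2 * pi)) = sin y.
  case: k => m; first exact: H.
  have [] := H (x + (Negz m)%:~R * (2 * pi)) m.+1.
  by rewrite NegzE intrN mulNr subrK => -> ->.
elim: m y => [|m IH] y; first by rewrite mul0r addr0.
have -> : y + m.+1%:R * (2 * pi) = y + m%:R * (2 * pi) + pi *+ 2.
  by rewrite -natr1 mulrDl mul1r addrA [2 * pi]mulr_natl.
by rewrite !(cosD _ (pi *+ 2), sinD _ (pi *+ 2)) cos2pi sin2pi
  !(mulr1, mulr0, subr0, addr0).
Qed.

Lemma circle_cosE x : circle_cos (to_circle x) = cos x.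
Proof.
rewrite /circle_cos; have [k ->] := to_circle_repr x.
by case: (cos_sin_periodz x k).
Qed.

Lemma circle_sinE x : circle_sin (to_circle x) = sin x.
Proof.
rewrite /circle_sin; have [k ->] := to_circle_repr x.
by case: (cos_sin_periodz x k).
Qed.

(* e^{ia} *)
Definition expi (a : circle) : R[i] := (circle_cos a +i* circle_sin a)%C.

End Circle.

(* An "angle function" takes its values either in R or in R / 2 pi Z. *)
Inductive angle_kind := RealAngle | CircleAngle.

Definition angle (R : realType) (k : angle_kind) : zmodType :=
  match k with
  | RealAngle => R
  | CircleAngle => circle R
  end.

Definition angle_cover (R : realType) (k : angle_kind) : R -> angle R k :=
  match k with
  | RealAngle => id
  | CircleAngle => @to_circle R
  end.

Definition angle_mod (R : realType) (k : angle_kind) : angle R k -> circle R :=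
  match k with
  | RealAngle => @to_circle R
  | CircleAngle => id
  end.

Section Calculus.
Variable R : realType.

(* Meant for open [I]: the iterated derivatives at the points of [I] then only
   depend on the restriction of [f] to [I]. *)
Definition smooth_on (I : set R) (f : R -> R) : Prop :=
  forall (k : nat) (s : R), I s -> derivable (derive1n k f) s 1.

Definition csmooth_on (I : set R) (f : R -> R[i]) : Prop :=
  smooth_on I (fun s => complex.Re (f s)) /\
  smooth_on I (fun s => complex.Im (f s)).

Definition is_cderive (f : R -> R[i]) (s : R) (df : R[i]) : Prop :=
  is_derive s 1 (fun t => complex.Re (f t)) (complex.Re df) /\
  is_derive s 1 (fun t => complex.Im (f t)) (complex.Im df).

(* The smooth structure of R / 2 pi Z is the one for which the projection from
   R is a local diffeomorphism: smoothness and derivatives are read on local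
   lifts to R.  For [RealAngle] a lift is the function itself. *)
Definition asmooth_on (k : angle_kind) (I : set R) (f : R -> angle R k) : Prop :=
  forall s, I s -> exists (U : set R) (g : R -> R),
    [/\ open U, U s, smooth_on U g & forall t, U t -> f t = angle_cover k (g t)].

Definition is_aderive (k : angle_kind) (f : R -> angle R k) (s df : R) : Prop :=
  exists g : R -> R,
    (\forall t \near s, f t = angle_cover k (g t)) /\ is_derive s 1 g df.

(* The integral of f from a to b, with its sign when b < a. *)
Definition oriented_integral (a b : R) (f : R -> R) : R :=
  if a <= b then Rintegral (@lebesgue_measure R) `[a, b] f
  else - Rintegral (@lebesgue_measure R) `[b, a] f.

End Calculus.

Section Systems.
Variables (R : realType) (n : nat).

Definition system1 (lambda : 'I_n -> R) (alpha : R) (I : set R)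
    (kt : angle_kind) (theta : R -> angle R kt) (w : 'I_n -> R -> R[i]) : Prop :=
  forall s, I s ->
    (forall j : 'I_n,
       is_cderive (w j) s
         ((lambda j)%:C%C * expi (angle_mod (theta s))
            * conjc (\prod_(k < n | k != j) w k s))) /\
    is_aderive theta s
      (alpha * complex.Im (expi (- angle_mod (theta s)) * \prod_(k < n) w k s)).

Definition lagrangian_set (lambda : 'I_n -> R) (C : R) (I : set R)
    (w : 'I_n -> R -> R[i]) : set 'rV[R[i]]_n :=
  [set z | exists (s : R) (x : 'I_n -> R),
     [/\ I s, \sum_(j < n) lambda j * x j ^+ 2 = C
       & z = \row_(j < n) ((x j)%:C%C * w j s)]].

Definition Qpoly (lambda a : 'I_n -> R) : {poly R} :=
  \prod_(j < n) ((a j)%:P + lambda j *: 'X).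

Definition system2 (lambda a : 'I_n -> R) (alpha : R) (I : set R)
    (kt kp : angle_kind) (u : R -> R) (phis : 'I_n -> R -> angle R kp)
    (phi : R -> angle R kp) (theta : R -> angle R kt) : Prop :=
  let Q := Qpoly lambda a in
  let delta s := angle_mod (phi s) - angle_mod (theta s) in
  forall s, I s ->
    [/\ is_derive s 1 u (2 * Num.sqrt Q.[u s] * circle_cos (delta s)),
        forall j : 'I_n,
          is_aderive (phis j) s
            (- (lambda j * Num.sqrt Q.[u s] * circle_sin (delta s)
                  / (a j + lambda j * u s))),
        is_aderive phi s
          (- (Num.sqrt Q.[u s] * derive1 (fun v : R => ln Q.[v]) (u s)
                * circle_sin (delta s)))
      & is_aderive theta s
          (alpha * Num.sqrt Q.[u s] * circle_sin (delta s))].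

Definition first_integral (lambda a : 'I_n -> R) (alpha : R) (I : set R)
    (kt kp : angle_kind) (u : R -> R) (phi : R -> angle R kp)
    (theta : R -> angle R kt) : Prop :=
  exists A : R, forall s, I s ->
    Num.sqrt (Qpoly lambda a).[u s] * expR (alpha * u s / 2)
      * circle_sin (angle_mod (phi s) - angle_mod (theta s)) = A.

End Systems.

(* Main.v *)
Require Import Defs.
From HB Require Import structures.
From mathcomp Require Import all_boot all_order all_algebra generic_quotient.
From mathcomp Require Import all_classical all_reals all_analysis.
From mathcomp Require Import complex.
From mathcomp Require Import ring.

Set Implicit Arguments.
Unset Strict Implicit.
Unset Printing Implicit Defensive.

Import Order.TTheory GRing.Theory Num.Theory.
Import numFieldNormedType.Exports.

Local Open Scope classical_set_scope.
Local Open Scope ring_scope.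

(**
The system (1) is read in polar coordinates.  Put P = r_1 ... r_n and
delta = phi - theta.  Since the product of the w_k with k <> j is
(P / r_j) e^(i (phi - phi_j)), the equation for w_j divided by e^(i phi_j) says

    r_j' + i r_j phi_j' = (lambda_j P / r_j) e^(- i delta)

([conj_prod_polar], [polar_equation_iff]).

The real part gives (r_j^2)' = 2 lambda_j P cos delta, so the functions
r_j^2 / lambda_j all have the same derivative, which is u'.  The fundamental
theorem of calculus turns this into r_j^2 = alpha_j + lambda_j u
([sqr_radius_affine]).  Hence P = Q(u)^(1/2), and the real and imaginary parts
of the displayed equation are the equations for u and phi_j in (2).  The
equation for phi is the sum of those for the phi_j, because
(ln Q)' = sum_j lambda_j / (alpha_j + lambda_j u), and the equation for theta
is the imaginary part of P e^(i delta).  Each of these steps can be reversed as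
long as the radii are the square roots of alpha_j + lambda_j v for a
differentiable v ([system1_iff_system2]).  That equivalence is applied both to
the given solution and to arbitrary v.

For the first integral, write Q(u)^(1/2) e^(alpha u / 2) as
exp (ln Q(u) / 2 + alpha u / 2).  By (2) its logarithmic derivative is
Q(u)^(1/2) ((ln Q)' + alpha) cos delta, while (sin delta)' is
- Q(u)^(1/2) ((ln Q)' + alpha) sin delta cos delta, so the derivative of
the product with sin delta vanishes ([first_integral_of_system2]).

An angle may take its values in R or in R / 2 pi Z.  Derivatives of angles are
read on local lifts, and the values of angles enter only through cos and sin,
which do not depend on the lift.
*)

(** * Trigonometry on the circle *)

Section CircleTrigonometry.
Variable R : realType.
Implicit Types (a b : circle R) (x : R).

Lemma to_circle_surj a : exists x, a = to_circle x.
Proof.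
by exists (repr (a : Quotient.quot (@two_pi_int R))); rewrite /to_circle reprK.
Qed.

Lemma expi_to_circle x : expi (to_circle x) = (cos x +i* sin x)%C.
Proof. by rewrite /expi circle_cosE circle_sinE. Qed.

Lemma expiD a b : expi (a + b) = expi a * expi b.
Proof.
have [x ->] := to_circle_surj a; have [y ->] := to_circle_surj b.
rewrite -raddfD -/(to_circle _) !expi_to_circle cosD sinD.
by apply/eqP; rewrite eq_complex /= eqxx addrC eqxx.
Qed.

Lemma expi0 : expi (0 : circle R) = 1.
Proof.
rewrite (_ : 0 = to_circle 0); last by rewrite /to_circle raddf0.
by rewrite expi_to_circle cos0 sin0.
Qed.

Lemma expiN a : expi (- a) = conjc (expi a).
Proof.
have [x ->] := to_circle_surj a; rewrite -raddfN -/(to_circle _).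
by rewrite !expi_to_circle cosN sinN.
Qed.

Lemma expi_sum n (P : pred 'I_n) (f : 'I_n -> circle R) :
  expi (\sum_(i | P i) f i) = \prod_(i | P i) expi (f i).
Proof. exact: (big_morph _ expiD expi0). Qed.

Lemma expiMN a : expi a * expi (- a) = 1.
Proof. by rewrite -expiD subrr expi0. Qed.

Lemma circle_cosN a : circle_cos (- a) = circle_cos a.
Proof. by have /(congr1 (@complex.Re R)) := expiN a. Qed.

Lemma circle_sinN a : circle_sin (- a) = - circle_sin a.
Proof. by have /(congr1 (@complex.Im R)) := expiN a. Qed.

End CircleTrigonometry.

(** * Derivatives of angles *)

Section AngleCalculus.
Variables (R : realType).

Lemma angle_mod_cover k (x : R) : angle_mod (angle_cover k x) = to_circle x.
Proof. by case: k. Qed.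

Lemma angle_coverD k : {morph angle_cover k : x y / x + y :> R >-> x + y}.
Proof. by case: k => x y //=; rewrite -raddfD. Qed.

Lemma angle_cover0 k : angle_cover k (0 : R) = 0.
Proof. by case: k => //=; rewrite /to_circle raddf0. Qed.

Lemma angle_modD k : {morph @angle_mod R k : x y / x + y}.
Proof. by case: k => x y //=; rewrite -raddfD. Qed.

Lemma angle_mod0 k : @angle_mod R k 0 = 0.
Proof. by case: k => //=; rewrite /to_circle raddf0. Qed.

Lemma angle_mod_sum k n (P : pred 'I_n) (f : 'I_n -> angle R k) :
  angle_mod (\sum_(i | P i) f i) = \sum_(i | P i) angle_mod (f i).
Proof. exact: (big_morph _ (@angle_modD k) (angle_mod0 k)). Qed.

Lemma is_derive_eqfun (f g : R -> R) (s df : R) :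
  f =1 g -> is_derive s 1 f df -> is_derive s 1 g df.
Proof. by move=> /funext ->. Qed.

Lemma is_derive_unique (f : R -> R) (s a b : R) :
  is_derive s 1 f a -> is_derive s 1 f b -> a = b.
Proof. by move=> [_ <-] [_ <-]. Qed.

Lemma is_derive_continuous (f : R -> R) (s df : R) :
  is_derive s 1 f df -> {for s, continuous f}.
Proof. by case=> /derivable1_diffP /differentiable_continuous. Qed.

Lemma asmooth_on_derive k (I : set R) (f : R -> angle R k) s :
  asmooth_on I f -> I s -> exists df, is_aderive f s df.
Proof.
move=> fI /fI [U [g [oU Us gU fg]]]; exists ('D_1 g s), g; split.
  by apply: filterS (open_nbhs_nbhs (conj oU Us)) => t /fg.
by apply: DeriveDef => //; exact: (gU 0%N).
Qed.

Lemma smooth_on_derive (I : set R) (f : R -> R) s :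
  smooth_on I f -> I s -> exists df, is_derive s 1 f df.
Proof.
by move=> fI Is; exists ('D_1 f s); apply: DeriveDef => //; exact: (fI 0%N).
Qed.

Lemma is_aderive_ext k (f h : R -> angle R k) s df :
  (\forall t \near s, f t = h t) -> is_aderive f s df -> is_aderive h s df.
Proof.
move=> fh [g [fg dg]]; exists g; split => //.
by near=> t; rewrite -(near fh t) // (near fg t).
Unshelve. all: by end_near. Qed.

(** Every angle can be pushed to the circle without changing its derivative,
which reduces the two kinds of angles to one. *)
Lemma is_aderive_mod k (f : R -> angle R k) s df :
  is_aderive f s df ->
  is_aderive (k := CircleAngle) (fun t => angle_mod (f t)) s df.
Proof.
move=> [g [fg dg]]; exists g; split => //.
by apply: filterS fg => t ->; rewrite angle_mod_cover.
Qed.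

Lemma is_aderiveB (f h : R -> circle R) s df dh :
  is_aderive (k := CircleAngle) f s df ->
  is_aderive (k := CircleAngle) h s dh ->
  is_aderive (k := CircleAngle) (fun t => f t - h t) s (df - dh).
Proof.
move=> [g [fg dg]] [l [hl dl]]; exists (fun t => g t - l t); split; last first.
  exact: is_deriveB.
by near=> t; rewrite (near fg t) // (near hl t) //= to_circleB.
Unshelve. all: by end_near. Qed.

Lemma is_derive_sum_fun n (f : 'I_n -> R -> R) (s : R) (df : 'I_n -> R) :
  (forall i, is_derive s 1 (f i) (df i)) ->
  is_derive s 1 (fun t => \sum_(i < n) f i t) (\sum_(i < n) df i).
Proof.
move=> fdf; have := @is_derive_sum _ _ _ n f s 1 df fdf.
by rewrite (_ : \sum_(i < n) f i = fun t => \sum_(i < n) f i t) //;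
  apply/funext => t; rewrite fct_sumE.
Qed.

(** Finitely many local lifts have a common neighbourhood of validity. *)
Lemma is_aderive_sum k n (f : 'I_n -> R -> angle R k) s (df : 'I_n -> R) :
  (forall i, is_aderive (f i) s (df i)) ->
  is_aderive (fun t => \sum_(i < n) f i t) s (\sum_(i < n) df i).
Proof.
move=> /choice[g fg]; exists (fun t => \sum_(i < n) g i t); split; last first.
  by apply: is_derive_sum_fun => i; case: (fg i).
have : \forall t \near s, forall i, f i t = angle_cover k (g i t).
  by apply: (@filter_forall _ _ (fun i t => f i t = angle_cover k (g i t)) _
    (nbhs_filter s)) => i; case: (fg i).
apply: filterS => t ft; rewrite (big_morph _ (@angle_coverD k) (angle_cover0 k)).
exact: eq_bigr.
Qed.

Lemma is_derive_circle_cos (f : R -> circle R) s df :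
  is_aderive (k := CircleAngle) f s df ->
  is_derive s 1 (fun t => circle_cos (f t)) (- circle_sin (f s) * df).
Proof.
move=> [g [fg dg]]; rewrite (nbhs_singleton fg) /= circle_sinE.
apply: (@near_eq_is_derive _ _ _ (fun t => cos (g t))).
  by apply: filterS fg => t ->; rewrite circle_cosE.
Qed.

Lemma is_derive_circle_sin (f : R -> circle R) s df :
  is_aderive (k := CircleAngle) f s df ->
  is_derive s 1 (fun t => circle_sin (f t)) (circle_cos (f s) * df).
Proof.
move=> [g [fg dg]]; rewrite (nbhs_singleton fg) /= circle_cosE.
apply: (@near_eq_is_derive _ _ _ (fun t => sin (g t))).
  by apply: filterS fg => t ->; rewrite circle_sinE.
Qed.

End AngleCalculus.

(** * Calculus on an interval *)

Lemma near_open (R : realType) (I : set R) s :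
  open I -> I s -> \forall t \near s, I t.
Proof. by move=> oI Is; exact: open_nbhs_nbhs. Qed.

Section Interval.
Variables (R : realType) (I : set R).
Hypothesis I_itv : is_interval I.

Lemma derive0_constant (F : R -> R) :
  (forall s, I s -> is_derive s 1 F 0) -> forall a b, I a -> I b -> F a = F b.
Proof.
move=> dF a b; wlog ab : a b / a <= b.
  move=> H Ia Ib; have [ab|/ltW ab] := leP a b; first exact: H.
  by apply/esym; exact: H.
move=> Ia Ib.
have Iab x : x \in `[a, b]%R -> I x.
  by rewrite in_itv => /= xab; exact: I_itv xab.
have [| |c _] := @MVT_segment R F (fun=> 0) a b ab.
- by move=> x xab; apply: dF; apply: Iab; exact: subset_itv_oo_cc.
- by apply: derivable_within_continuous => x /Iab /dF [].
- by rewrite mul0r => /subr0_eq ->.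
Qed.

(** The fundamental theorem of calculus in the form that needs an antiderivative
in advance; it applies to both orders of the bounds. *)
Lemma oriented_integral_derive (f F : R -> R) :
  (forall s, I s -> is_derive s 1 F (f s)) ->
  (forall s, I s -> {for s, continuous f}) ->
  forall a b, I a -> I b -> oriented_integral a b f = F b - F a.
Proof.
move=> dF cf.
suff H a b : a <= b -> I a -> I b ->
    Rintegral (@lebesgue_measure R) `[a, b] f = F b - F a.
  move=> a b Ia Ib; rewrite /oriented_integral.
  by have [ab|/ltW ab] := leP a b; rewrite H // opprB.
rewrite le_eqVlt => /predU1P[<- Ia _|ab Ia Ib].
  by rewrite set_itv1 Rintegral_set1 subrr.
have Iab x : x \in `[a, b]%R -> I x.
  by rewrite in_itv => /= xab; exact: I_itv xab.
rewrite /Rintegral (@continuous_FTC2 _ f F) //.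
- by apply: continuous_in_subspaceT => x; rewrite inE => /Iab; exact: cf.
- split.
  + by move=> x /subset_itv_oo_cc /Iab /dF [].
  + exact/cvg_at_right_filter/(is_derive_continuous (dF _ Ia)).
  + exact/cvg_at_left_filter/(is_derive_continuous (dF _ Ib)).
- move=> x /subset_itv_oo_cc /Iab /dF [_ dFx]; by rewrite derive1E.
Qed.

End Interval.

(** * The equations in polar coordinates *)

Section Polar.
Variables (R : realType) (k : angle_kind).

(** The product rule (rho e^(i f))' = (rho' + i rho f') e^(i f). *)
Lemma is_cderive_polar (rho : R -> R) (f : R -> angle R k) (s dr df : R) :
  is_derive s 1 rho dr -> is_aderive f s df ->
  is_cderive (fun t => (rho t)%:C%C * expi (angle_mod (f t))) s
    ((dr +i* (rho s * df))%C * expi (angle_mod (f s))).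
Proof.
move=> drho /is_aderive_mod df'.
have dc := is_derive_circle_cos df'; have ds := is_derive_circle_sin df'.
split => /=.
- apply: (is_derive_eqfun (f := fun t => rho t * circle_cos (angle_mod (f t)))).
    by move=> t; rewrite mul0r subr0.
  apply: is_derive_eq (is_deriveM drho dc) _.
  by rewrite /GRing.scale /=; ring.
- apply: (is_derive_eqfun (f := fun t => rho t * circle_sin (angle_mod (f t)))).
    by move=> t; rewrite mul0r addr0.
  apply: is_derive_eq (is_deriveM drho ds) _.
  by rewrite /GRing.scale /=; ring.
Qed.

Lemma is_cderive_ext (f g : R -> R[i]) s df :
  (\forall t \near s, f t = g t) -> is_cderive f s df -> is_cderive g s df.
Proof.
move=> fg [re im]; split.
- by apply: near_eq_is_derive re; apply: filterS fg => t ->.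
- by apply: near_eq_is_derive im; apply: filterS fg => t ->.
Qed.

Lemma is_cderive_unique (f : R -> R[i]) (s : R) (a b : R[i]) :
  is_cderive f s a -> is_cderive f s b -> a = b.
Proof.
move=> [ra ia] [rb ib]; apply/eqP; rewrite eq_complex.
by rewrite (is_derive_unique ra rb) (is_derive_unique ia ib) !eqxx.
Qed.

Lemma prod_polar n (P : pred 'I_n) (rho : 'I_n -> R) (f : 'I_n -> angle R k) :
  \prod_(j < n | P j) ((rho j)%:C%C * expi (angle_mod (f j))) =
  (\prod_(j < n | P j) rho j)%:C%C * expi (angle_mod (\sum_(j < n | P j) f j)).
Proof. by rewrite big_split /= -rmorph_prod angle_mod_sum expi_sum. Qed.

(** Omitting w_j from the product and conjugating leaves the phase
theta - (phi - phi_j) = phi_j - delta.  The factor e^(i phi_j) is kept apart,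
so that it cancels against the one in [is_cderive_polar]. *)
Lemma conj_prod_polar n (j : 'I_n) (rho : 'I_n -> R) (f : 'I_n -> angle R k)
    (l : R) (th : circle R) : rho j != 0 ->
  let delta := angle_mod (\sum_(i < n) f i) - th in
  let c := l * \prod_(i < n) rho i / rho j in
  l%:C%C * expi th
    * conjc (\prod_(i < n | i != j) ((rho i)%:C%C * expi (angle_mod (f i)))) =
  ((c * circle_cos delta) +i* (- (c * circle_sin delta)))%C
    * expi (angle_mod (f j)).
Proof.
move=> rj0 delta c.
have -> : ((c * circle_cos delta) +i* (- (c * circle_sin delta)))%C =
    c%:C%C * expi (- delta).
  rewrite /expi circle_cosN circle_sinN.
  by apply/eqP; rewrite eq_complex /= !mul0r subr0 addr0 mulrN !eqxx.
have conjM (x y : R[i]) : conjc (x * y) = conjc x * conjc y by exact: rmorphM.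
rewrite prod_polar conjM conjc_real -expiN -!mulrA -expiD.
have -> : - delta + angle_mod (f j) =
    th - angle_mod (\sum_(i < n | i != j) f i).
  rewrite /delta !angle_mod_sum (bigD1 j) //= opprB opprD addrA.
  by rewrite addrAC subrK.
have -> : c = l * \prod_(i < n | i != j) rho i.
  by rewrite /c (bigD1 j) //=; field.
by rewrite expiD (rmorphM (real_complex R)) /=; ring.
Qed.

End Polar.

(** * The polynomial Q *)

Section QPolynomial.
Variables (R : realType) (n : nat) (lambda a : 'I_n -> R).

Lemma horner_Qpoly x :
  (Qpoly lambda a).[x] = \prod_(j < n) (a j + lambda j * x).
Proof.
by rewrite /Qpoly horner_prod; apply: eq_bigr => j _; rewrite !hornerE.
Qed.

Lemma size_Qpoly : (forall j, lambda j != 0) -> size (Qpoly lambda a) = n.+1.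
Proof.
move=> l0.
have sz j : size ((a j)%:P + lambda j *: 'X) = 2.
  rewrite addrC size_polyDl size_scale ?size_polyX //.
  by rewrite (leq_ltn_trans (size_polyC_leq1 _)).
rewrite /Qpoly size_prod => [|j _]; last by rewrite -size_poly_gt0 sz.
rewrite (eq_bigr (fun=> 2%N)) // sum_nat_const card_ord.
by rewrite muln2 -addnn -addSn addnK.
Qed.

(** Under the substitution of radii sqrt (a_j + lambda_j x), this is the
product of the moduli of the w_j. *)
Lemma sqrt_Qpoly x : (forall j, 0 < a j + lambda j * x) ->
  Num.sqrt (Qpoly lambda a).[x] = \prod_(j < n) Num.sqrt (a j + lambda j * x).
Proof.
move=> pos; rewrite horner_Qpoly.
rewrite (eq_bigr (fun j => Num.sqrt (a j + lambda j * x) ^+ 2)); last first.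
  by move=> j _; rewrite sqr_sqrtr // ltW.
by rewrite prodrXl sqrtr_sqr ger0_norm // prodr_ge0 // => j _; exact: sqrtr_ge0.
Qed.

Lemma is_derive_affine (b l : R) (v : R -> R) (s dv : R) :
  is_derive s 1 v dv -> is_derive s 1 (fun t => b + l * v t) (l * dv).
Proof.
move=> dv'; have h := is_deriveD (is_derive_cst b s 1) (is_deriveZ l dv').
by apply: is_derive_eq h _; rewrite add0r.
Qed.

(** All factors remain positive near x, where ln Q is the sum of the logarithms
of the factors. *)
Lemma is_derive_ln_Qpoly x : (forall j, 0 < a j + lambda j * x) ->
  is_derive x 1 (fun v => ln (Qpoly lambda a).[v])
    (\sum_(j < n) lambda j / (a j + lambda j * x)).
Proof.
move=> pos.
have daff j : is_derive x 1 (fun t => a j + lambda j * t) (lambda j).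
  by apply: is_derive_eq (is_derive_affine _ _ (is_derive_id x 1)) _;
    rewrite mulr1.
apply: (@near_eq_is_derive _ _ _ (fun v => \sum_(j < n) ln (a j + lambda j * v))).
  have : \forall t \near x, forall j, 0 < a j + lambda j * t.
    apply: (@filter_forall _ _ (fun j t => 0 < a j + lambda j * t) _
      (nbhs_filter x)) => j.
    by have := is_derive_continuous (daff j) => /cvgr_gt; apply.
  apply: filterS => t post; rewrite horner_Qpoly.
  suff [_ ->] : 0 < \prod_(j < n) (a j + lambda j * t) /\
    ln (\prod_(j < n) (a j + lambda j * t)) =
      \sum_(j < n) ln (a j + lambda j * t) by [].
  elim/big_rec2 : _ => [|j y z _ [z0 <-]]; first by rewrite ln1.
  by split; [exact: mulr_gt0 | rewrite lnM // posrE].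
apply: is_derive_sum_fun => j.
apply: is_derive_eq (@is_derive1_comp _ (@ln R) (fun t => a j + lambda j * t)
  x _ _ (is_derive1_ln (pos j)) (daff j)) _.
by rewrite mulrC.
Qed.

Lemma derive1_ln_Qpoly x : (forall j, 0 < a j + lambda j * x) ->
  derive1 (fun v => ln (Qpoly lambda a).[v]) x =
    \sum_(j < n) lambda j / (a j + lambda j * x).
Proof. by move=> /is_derive_ln_Qpoly [_ <-]; rewrite derive1E. Qed.

End QPolynomial.

(** * Equivalence of the two systems, and the first integral *)

Section Equivalence.
Variables (R : realType) (n : nat) (kp : angle_kind).

(** The j-th complex equation of (1) splits into a radial and an angular
equation: after cancelling e^(i phi_j), compare real and imaginary parts. *)
Lemma polar_equation_iff (l : R) (rho : 'I_n -> R -> R)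
    (psis : 'I_n -> R -> angle R kp) (th : circle R) (s dr df : R) (j : 'I_n) :
  rho j s != 0 -> is_derive s 1 (rho j) dr -> is_aderive (psis j) s df ->
  let delta := angle_mod (\sum_(i < n) psis i s) - th in
  let c := l * \prod_(i < n) rho i s / rho j s in
  is_cderive (fun t => (rho j t)%:C%C * expi (angle_mod (psis j t))) s
    (l%:C%C * expi th * conjc (\prod_(i < n | i != j)
        ((rho i s)%:C%C * expi (angle_mod (psis i s))))) <->
  dr = c * circle_cos delta /\ rho j s * df = - (c * circle_sin delta).
Proof.
move=> rj0 drho dpsi delta c; have dw := is_cderive_polar drho dpsi.
rewrite (conj_prod_polar _ _ _ rj0) -/delta -/c; split=> [dw'|[<- <-] //].
have := is_cderive_unique dw dw'.
move=> /(congr1 (fun z => z * expi (- angle_mod (psis j s)))).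
by rewrite -!mulrA !expiMN !mulr1 => -[-> ->].
Qed.

Lemma Im_prod_polar (rho : 'I_n -> R) (psis : 'I_n -> angle R kp)
    (th : circle R) :
  complex.Im (expi (- th) *
     \prod_(i < n) ((rho i)%:C%C * expi (angle_mod (psis i)))) =
  \prod_(i < n) rho i * circle_sin (angle_mod (\sum_(i < n) psis i) - th).
Proof.
by rewrite prod_polar mulrC -mulrA -expiD /= mul0r addr0.
Qed.

End Equivalence.

Section Systems.
Variables (R : realType) (n : nat) (n_ge1 : (1 <= n)%N).
Variables (lambda a : 'I_n -> R) (alpha : R) (I : set R).
Hypotheses (lambda_neq0 : forall j, lambda j != 0) (I_open : open I).
Variables (kt kp : angle_kind) (v : R -> R).
Variables (psis : 'I_n -> R -> angle R kp) (psi : R -> angle R kp).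
Variable theta : R -> angle R kt.
Hypothesis pos : forall j s, I s -> 0 < a j + lambda j * v s.

(** Differentiability at the points of I is all that is asked of v and of the
angles, so that the lemma covers a function u defined by an integral as well as
smooth v. *)
Lemma system1_iff_system2 :
  (forall s, I s -> exists dv, is_derive s 1 v dv) ->
  (forall j s, I s -> exists df, is_aderive (psis j) s df) ->
  (forall s, I s -> psi s = \sum_(j < n) psis j s) ->
  system1 lambda alpha I theta
    (fun j s => (Num.sqrt (a j + lambda j * v s))%:C%C
                  * expi (angle_mod (psis j s)))
  <-> system2 lambda a alpha I v psis psi theta.
Proof.
move=> v_der psis_der psi_sum; pose rho j s := Num.sqrt (a j + lambda j * v s).
have rho_gt0 j s : I s -> 0 < rho j s by move=> /(pos j); rewrite sqrtr_gt0.
have rho2 j s : I s -> a j + lambda j * v s = rho j s ^+ 2.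
  by move=> Is; rewrite sqr_sqrtr // ltW // pos.
have drho j s dv : I s -> is_derive s 1 v dv ->
    is_derive s 1 (rho j) (lambda j * dv / (2 * rho j s)).
  move=> Is /(is_derive_affine (a j) (lambda j)) dv'.
  apply: is_derive_eq (@is_derive1_comp _ Num.sqrt
    (fun t => a j + lambda j * v t) s _ _ (is_derive1_sqrt (pos j Is)) dv') _.
  by rewrite mulrC.
have sqrtQ s : I s ->
    Num.sqrt (Qpoly lambda a).[v s] = \prod_(j < n) rho j s.
  by move=> Is; apply: sqrt_Qpoly => j; exact: pos.
have angular c df p : c != 0 -> forall l sn : R,
    c * df = - (l * p / c * sn) <-> df = - (l * p * sn / c ^+ 2).
  move=> c0 l sn; split=> [h|->]; last by field.
  by apply: (mulfI c0); rewrite h; field.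
have theta_eq s : I s ->
    alpha * complex.Im (expi (- angle_mod (theta s)) *
      \prod_(k < n) ((rho k s)%:C%C * expi (angle_mod (psis k s)))) =
    alpha * Num.sqrt (Qpoly lambda a).[v s]
      * circle_sin (angle_mod (psi s) - angle_mod (theta s)).
  by move=> Is; rewrite Im_prod_polar -psi_sum // sqrtQ // mulrA.
split=> [sys|sys s Is].
- rewrite /system2 /= => s Is; have [dw dth] := sys s Is.
  have [dv v_dv] := v_der s Is.
  have /choice[df psis_df] := fun j => psis_der j s Is.
  have eqs j := (polar_equation_iff (lambda j) (angle_mod (theta s))
    (lt0r_neq0 (rho_gt0 j s Is)) (drho j s dv Is v_dv) (psis_df j)).1 (dw j).
  set P := Num.sqrt (Qpoly lambda a).[v s].
  set delta := angle_mod (psi s) - angle_mod (theta s).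
  have psis_der' j : is_aderive (psis j) s
      (- (lambda j * P * circle_sin delta / (a j + lambda j * v s))).
    have [_] := eqs j; rewrite -psi_sum // -sqrtQ // -/P -/delta.
    move=> /angular-/(_ (lt0r_neq0 (rho_gt0 j s Is))) df_eq.
    by rewrite rho2 // -df_eq.
  split=> //.
  (* Any single radial equation determines dv; an index exists since n >= 1. *)
  + have [+ _] := eqs (Ordinal n_ge1); set j := Ordinal _.
    have rj := lt0r_neq0 (rho_gt0 j s Is).
    rewrite -psi_sum // -sqrtQ // -/P -/delta => dv_eq.
    suff <- : dv = 2 * P * circle_cos delta by [].
    have lj := lambda_neq0 j.
    apply: (mulfI (x := lambda j / (2 * rho j s))).
      by rewrite mulf_neq0 // invr_neq0 // mulf_neq0.
    by rewrite mulrAC dv_eq; field; rewrite rj.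
  + rewrite derive1_ln_Qpoly; last by move=> j; exact: pos.
    apply: (@is_aderive_ext _ _ (fun t => \sum_(j < n) psis j t)).
      by apply: filterS (near_open I_open Is) => t It; rewrite psi_sum.
    rewrite mulr_sumr mulr_suml -sumrN.
    have -> : \sum_(i < n) - (P * (lambda i / (a i + lambda i * v s))
        * circle_sin delta) =
      \sum_(i < n) - (lambda i * P * circle_sin delta / (a i + lambda i * v s)).
      by apply: eq_bigr => j _; congr (- _); rewrite -!mulrA; ring.
    exact: is_aderive_sum.
  + by rewrite -/P -/delta -theta_eq.
- have [v_dv psis_df _ dth] := sys s Is; split; last first.
    by rewrite -[X in is_aderive _ _ X]theta_eq // in dth.
  move=> j; have rj := lt0r_neq0 (rho_gt0 j s Is).
  apply/(polar_equation_iff (lambda j) (angle_mod (theta s)) rj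
    (drho j s _ Is v_dv) (psis_df j)).
  rewrite -psi_sum // -sqrtQ //; split; first by field.
  by apply/angular => //; rewrite rho2.
Qed.

Lemma first_integral_of_system2 s0 : is_interval I -> I s0 ->
  system2 lambda a alpha I v psis psi theta ->
  first_integral lambda a alpha I v psi theta.
Proof.
move=> I_itv Is0 sys; pose F s :=
  Num.sqrt (Qpoly lambda a).[v s] * expR (alpha * v s / 2)
      * circle_sin (angle_mod (psi s) - angle_mod (theta s)).
exists (F s0) => s Is; rewrite -/(F s).
apply: (derive0_constant I_itv _ Is Is0) => {Is}s Is.
have [v_dv _ dpsi dtheta] := sys s Is.
set P := Num.sqrt _ in v_dv dpsi dtheta.
set delta := angle_mod (psi s) - angle_mod (theta s) in v_dv dpsi dtheta.
have posj j : 0 < a j + lambda j * v s by exact: pos.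
have dsin := is_derive_circle_sin
  (is_aderiveB (is_aderive_mod dpsi) (is_aderive_mod dtheta)).
rewrite (derive1_ln_Qpoly posj) in dsin.
have dlnQ := @is_derive1_comp _ (fun x => ln (Qpoly lambda a).[x]) v s _ _
  (is_derive_ln_Qpoly posj) v_dv.
(* Passing to the exponential makes (ln Q)' appear in the derivative of the
   square root of Q, in the same form as in the equation for psi. *)
pose E t := 2^-1 * ln (Qpoly lambda a).[v t] + alpha / 2 * v t.
have QE t : I t -> expR (E t) =
    Num.sqrt (Qpoly lambda a).[v t] * expR (alpha * v t / 2).
  move=> It; rewrite /E expRD; congr (_ * expR _); last by rewrite mulrAC.
  have Q0 : 0 < (Qpoly lambda a).[v t].
    by rewrite horner_Qpoly prodr_gt0 // => j _; exact: pos.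
  rewrite -[in RHS](lnK Q0) -[X in Num.sqrt (expR X)](@mulVKf _ 2) //.
  by rewrite expRM_natl sqrtr_sqr ger0_norm ?expR_ge0.
have dE := is_derive1_comp (is_derive_expR (E s))
  (is_deriveD (is_deriveZ 2^-1 dlnQ) (is_deriveZ (alpha / 2) v_dv)).
apply: (@near_eq_is_derive _ _ _ (fun t => expR (E t) *
    circle_sin (angle_mod (psi t) - angle_mod (theta t)))).
  by apply: filterS (near_open I_open Is) => t It; rewrite QE.
apply: is_derive_eq (is_deriveM dE dsin) _.
rewrite /GRing.scale /= -/delta; set S := \sum_(j < n) _.
by field.
Qed.

End Systems.

(** * The squared radii are affine in u *)

Section Radii.
Variables (R : realType) (n : nat) (I : set R).
Variables (lambda : 'I_n -> R) (alpha : R) (kt kp : angle_kind).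
Variables (theta : R -> angle R kt) (w : 'I_n -> R -> R[i]).
Variables (r : 'I_n -> R -> R) (phis : 'I_n -> R -> angle R kp).
Variable phi : R -> angle R kp.
Hypotheses (I_open : open I) (I_itv : is_interval I).
Hypothesis lambda_neq0 : forall j, lambda j != 0.
Hypothesis sys : system1 lambda alpha I theta w.
Hypothesis r_gt0 : forall j s, I s -> 0 < r j s.
Hypothesis r_der : forall j s, I s -> exists dr : R, is_derive s 1 (r j) dr.
Hypothesis theta_der : forall s, I s -> exists df, is_aderive theta s df.
Hypothesis phis_der : forall j s, I s -> exists df, is_aderive (phis j) s df.
Hypothesis w_polar : forall j s, I s ->
  w j s = (r j s)%:C%C * expi (angle_mod (phis j s)).
Hypothesis phi_sum : forall s, I s -> phi s = \sum_(j < n) phis j s.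

(** The derivative of r_j^2 / (2 lambda_j) is the same for all j: it is the
integrand of u, since r_j r_j' = lambda_j P cos delta. *)
Lemma is_derive_sqr_radius j s : I s ->
  is_derive s 1 (fun t => r j t ^+ 2 / (2 * lambda j))
    ((\prod_(i < n) r i s)
       * circle_cos (angle_mod (phi s) - angle_mod (theta s))).
Proof.
move=> Is; have [dr r_dr] := r_der j Is; have [df phis_df] := phis_der j Is.
have rj : r j s != 0 by rewrite lt0r_neq0 ?r_gt0.
have lj := lambda_neq0 j.
have [dw _] := sys Is; have {dw} := dw j.
rewrite (eq_bigr (fun i => (r i s)%:C%C * expi (angle_mod (phis i s))))
  => [|i _]; last exact: w_polar.
have w_near : \forall t \near s,
    w j t = (r j t)%:C%C * expi (angle_mod (phis j t)).
  by apply: filterS (near_open I_open Is) => t It; exact: w_polar.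
move=> /(is_cderive_ext w_near).
move=> /(polar_equation_iff (lambda j) (angle_mod (theta s)) rj r_dr phis_df).
rewrite -phi_sum // => -[dr_eq _].
apply: (@is_derive_eqfun _ (fun t => (2 * lambda j)^-1 * (r j t * r j t))).
  by move=> t; rewrite mulrC expr2.
apply: is_derive_eq (is_deriveZ (2 * lambda j)^-1 (is_deriveM r_dr r_dr)) _.
by rewrite /GRing.scale /= dr_eq; field; rewrite rj.
Qed.

Lemma sqr_radius_affine j s0 s : I s0 -> I s ->
  r j s ^+ 2 = r j s0 ^+ 2 + lambda j * (2 * oriented_integral s0 s
    (fun t => (\prod_(i < n) r i t)
                * circle_cos (angle_mod (phi t) - angle_mod (theta t)))).
Proof.
move=> Is0 Is; have lj := lambda_neq0 j.
rewrite (oriented_integral_derive I_itv (fun t It => is_derive_sqr_radius j It))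
  //; first by field.
move=> t It; apply: cvgM.
  apply: cvg_big => [|i _]; first exact: (@mul_continuous R).
  by have [dr] := r_der i It; exact: is_derive_continuous.
have phi_der : exists df, is_aderive phi t df.
  have /choice[df phis_df] := fun i => phis_der i It.
  exists (\sum_(i < n) df i).
  apply: is_aderive_ext (is_aderive_sum phis_df).
  by apply: filterS (near_open I_open It) => x Ix; rewrite phi_sum.
have [dphi phi_df] := phi_der; have [dth th_df] := theta_der It.
exact: is_derive_continuous (is_derive_circle_cos
  (is_aderiveB (is_aderive_mod phi_df) (is_aderive_mod th_df))).
Qed.

End Radii.

Lemma system1_ext (R : realType) n (lambda : 'I_n -> R) (alpha : R) (I : set R)
    (kt : angle_kind) (theta : R -> angle R kt) (w z : 'I_n -> R -> R[i]) :
  open I -> (forall j s, I s -> w j s = z j s) ->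
  system1 lambda alpha I theta w -> system1 lambda alpha I theta z.
Proof.
move=> I_open wz sys s Is; have [dw dth] := sys s Is.
split=> [j|]; last first.
  by rewrite (eq_bigr (fun k => w k s)) // => k _; rewrite wz.
rewrite (eq_bigr (fun k => w k s)) => [|k _]; last by rewrite wz.
apply: is_cderive_ext (dw j).
by apply: filterS (near_open I_open Is) => t It; exact: wz.
Qed.

Lemma lagrangian_set_ext (R : realType) n (lambda : 'I_n -> R) (C : R)
    (I : set R) (w z : 'I_n -> R -> R[i]) :
  (forall j s, I s -> w j s = z j s) ->
  lagrangian_set lambda C I w = lagrangian_set lambda C I z.
Proof.
move=> wz; apply/seteqP; split=> y [s [x [Is xC ->]]]; exists s, x; split=> //;
by apply/rowP => j; rewrite !mxE wz.
Qed.

Theorem theoremB (R : realType) (n : nat) (n_ge1 : (1 <= n)%N)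
  (lambda : 'I_n -> R) (C alpha : R)
  (lambda_neq0 : forall j, lambda j != 0) (C_neq0 : C != 0)
  (I : set R) (I_open : open I) (I_itv : is_interval I)
  (kt kp : angle_kind)
  (theta : R -> angle R kt) (w : 'I_n -> R -> R[i])
  (theta_smooth : asmooth_on I theta)
  (w_smooth : forall j, csmooth_on I (w j))
  (w_neq0 : forall j s, I s -> w j s != 0)
  (w_theta_sys : system1 lambda alpha I theta w)
  (r : 'I_n -> R -> R) (phis : 'I_n -> R -> angle R kp) (phi : R -> angle R kp)
  (r_gt0 : forall j s, I s -> 0 < r j s)
  (r_smooth : forall j, smooth_on I (r j))
  (phis_smooth : forall j, asmooth_on I (phis j))
  (phi_smooth : asmooth_on I phi)
  (w_polar : forall j s, I s ->
     w j s = (r j s)%:C%C * expi (angle_mod (phis j s)))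
  (phi_sum : forall s, I s -> phi s = \sum_(j < n) phis j s)
  (s0 : R) (s0_in : I s0) :
  let u := fun s : R => 2 * oriented_integral s0 s
    (fun t => (\prod_(j < n) r j t)
                * circle_cos (angle_mod (phi t) - angle_mod (theta t))) in
  let a := fun j : 'I_n => r j s0 ^+ 2 in
  [/\ forall j s, I s -> r j s ^+ 2 = a j + lambda j * u s,
      size (Qpoly lambda a) = n.+1,
      system2 lambda a alpha I u phis phi theta
        /\ first_integral lambda a alpha I u phi theta,
      lagrangian_set lambda C I w =
        lagrangian_set lambda C I
          (fun j s => (Num.sqrt (a j + lambda j * u s))%:C%C
                        * expi (angle_mod (phis j s)))
    & forall (v : R -> R) (psis : 'I_n -> R -> angle R kp)
             (psi : R -> angle R kp) (vartheta : R -> angle R kt),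
        smooth_on I v ->
        (forall j, asmooth_on I (psis j)) ->
        asmooth_on I psi ->
        asmooth_on I vartheta ->
        (forall j s, I s -> 0 < a j + lambda j * v s) ->
        (forall s, I s -> psi s = \sum_(j < n) psis j s) ->
        (system1 lambda alpha I vartheta
           (fun j s => (Num.sqrt (a j + lambda j * v s))%:C%C
                         * expi (angle_mod (psis j s)))
         <-> system2 lambda a alpha I v psis psi vartheta)
        /\ (system2 lambda a alpha I v psis psi vartheta ->
            first_integral lambda a alpha I v psi vartheta)].
Proof.
move=> u a.
have r_der j s := smooth_on_derive (r_smooth j) (s := s).
have phis_der j s := asmooth_on_derive (phis_smooth j) (s := s).
have theta_der s := asmooth_on_derive theta_smooth (s := s).
have r2 j s : I s -> r j s ^+ 2 = a j + lambda j * u s.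
  exact: (sqr_radius_affine I_open I_itv lambda_neq0 w_theta_sys r_gt0 r_der
    theta_der phis_der w_polar phi_sum).
have pos j s : I s -> 0 < a j + lambda j * u s.
  by move=> Is; rewrite -r2 // exprn_gt0 // r_gt0.
have w_sqrt j s : I s -> w j s =
    (Num.sqrt (a j + lambda j * u s))%:C%C * expi (angle_mod (phis j s)).
  by move=> Is; rewrite -r2 // sqrtr_sqr gtr0_norm ?r_gt0 // w_polar.
have u_der s : I s -> exists du : R, is_derive s 1 u du.
  move=> Is; pose j := Ordinal n_ge1; have [dr r_dr] := r_der j s Is.
  (* On I, u is the smooth function (r_j^2 - a_j) / lambda_j for any index j. *)
  exists ((lambda j)^-1 * (r j s * dr + r j s * dr)).
  apply: (@near_eq_is_derive _ _ _ (fun t => (lambda j)^-1 * (r j t * r j t - a j))).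
    apply: filterS (near_open I_open Is) => t It.
    by rewrite -expr2 r2 // addrC addrA addNr add0r mulKf.
  have := is_deriveB (is_deriveM r_dr r_dr) (is_derive_cst (a j) s 1).
  by rewrite subr0; exact: is_deriveZ.
have sys2 : system2 lambda a alpha I u phis phi theta.
  apply/(system1_iff_system2 n_ge1 alpha lambda_neq0 I_open theta pos u_der
    phis_der phi_sum).
  exact: system1_ext I_open w_sqrt w_theta_sys.
split=> //.
- exact: size_Qpoly.
- split=> //.
  exact: (first_integral_of_system2 I_open pos I_itv s0_in sys2).
- exact: lagrangian_set_ext.
- move=> v psis psi vartheta v_smooth psis_smooth _ _ v_pos psi_sum; split.
    apply: (system1_iff_system2 n_ge1) => // s.
      exact: smooth_on_derive.
    by move=> t; exact: asmooth_on_derive.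
  exact: (first_integral_of_system2 I_open v_pos I_itv s0_in).
Qed.
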